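(* Let $c\in[0,\infty]$. Put $z_\infty:=-\left(8c\frac{1+q^4}{(1+q^2)^2}+1\right)^{-1/2}$ and $\kappa_c:=(1+\sqrt{c})\,z_\infty$, where for $c=\infty$ one uses the limit values $z_\infty=0$ and $\kappa_\infty=-\frac{1+q^2}{2\sqrt{2(1+q^4)}}$. Define the following elements of $P(S^2_{qc})$: $$x:=-i\,\frac{\sqrt{2(1+q^4)}}{1+q^2}\,\kappa_c\,(\widetilde B_c-\widetilde B_c^* ),\qquad y:=-\frac{\sqrt{2(1+q^4)}}{1+q^2}\,\kappa_c\,(\widetilde B_c+\widetilde B_c^* ),\qquad z:=-\frac{2(1+q^4)}{1+q^2}\,\kappa_c\,\widetilde A_c+z_\infty .$$ Then $x,y,z$ are self-adjoint, satisfy $x^2+y^2+z^2=1$, and generate the algebra $P(S^2_{qc})$.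
   Context: Fix $q\in\mathbb{R}$ with $0<|q|<1$. All algebras are unital and over $\mathbb{C}$. $P(S^2_{q\infty})$ is the quotient of the free $*$-algebra $\mathbb{C}\langle A,B\rangle$ by the two-sided $*$-ideal generated by the relations $A^*=A$, $BA=q^2AB$, $B^*B=-A^2+I$, $BB^*=-q^4A^2+I$. For $c\in[0,\infty)$, $P(S^2_{qc})$ is the quotient of the free $*$-algebra $\mathbb{C}\langle A_c,B_c\rangle$ by the two-sided $*$-ideal generated by the relations $A_c^*=A_c$, $B_cA_c=q^2A_cB_c$, $B_c^*B_c=A_c-A_c^2+cI$, $B_cB_c^*=q^2A_c-q^4A_c^2+cI$. For $c\in[0,\infty)$ put $\widetilde A_c:=A_c/(1+\sqrt c)$ and $\widetilde B_c:=B_c/(1+\sqrt c)$; for $c=\infty$ put $\widetilde A_\infty:=A$ and $\widetilde B_\infty:=B$. *)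

(* Defs.v *)
From HB Require Import structures.
From mathcomp Require Import all_boot all_order all_algebra.
From mathcomp Require Import finmap monalg.
From mathcomp Require Import generic_quotient ring_quotient.
From mathcomp Require Import complex.
From mathcomp Require Import boolp classical_sets reals constructive_ereal.

Set Implicit Arguments.
Unset Strict Implicit.
Unset Printing Implicit Defensive.

Import Order.TTheory GRing.Theory Num.Theory.

Local Open Scope ring_scope.
Local Open Scope classical_set_scope.

HB.mixin Record Algebra_isStar (C : numClosedFieldType) A
    of GRing.Algebra C A := {
  star : A -> A;
  starK : involutive star;
  starD : {morph star : x y / x + y};
  starM : forall x y, star (x * y) = star y * star x;
  starZ : forall (a : C) x, star (a *: x) = a^* *: star x
}.

#[short(type="starAlgType")]
HB.structure Definition StarAlgebra (C : numClosedFieldType) :=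
  {A of GRing.Algebra C A & Algebra_isStar C A}.

Section StarTheory.
Context (C : numClosedFieldType) (A : starAlgType C).
Implicit Types (x y : A).

Lemma star0 : star (0 : A) = 0.
Proof. by apply: (addrI (star 0)); rewrite -starD !addr0. Qed.

Lemma starN x : star (- x) = - star x.
Proof. by apply: (addrI (star x)); rewrite -starD !subrr star0. Qed.

Lemma starB x y : star (x - y) = star x - star y.
Proof. by rewrite starD starN. Qed.

Lemma star1 : star (1 : A) = 1.
Proof. by rewrite -[LHS]mulr1 -{2}[1]starK -starM mulr1 starK. Qed.

End StarTheory.

(* Closure under scalars follows from closure under multiplication, because
   the algebras are unital. *)
Definition is_star_ideal (C : numClosedFieldType) (A : starAlgType C)
    (I : set A) : Prop :=
  [/\ I 0,
      forall x y, I x -> I y -> I (x - y),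
      forall a x, I x -> I (a * x),
      forall a x, I x -> I (x * a) &
      forall x, I x -> I (star x)].

Definition star_ideal_gen (C : numClosedFieldType) (A : starAlgType C)
    (S : set A) : set A :=
  smallest (@is_star_ideal C A) S.

Lemma star_ideal_genP (C : numClosedFieldType) (A : starAlgType C)
  (S : set A) : is_star_ideal (star_ideal_gen S).
Proof.
split.
- by move=> I [[]].
- move=> x y Ix Iy I [hI SI]; case: (hI) => _ hB _ _ _.
  by apply: hB; [apply: Ix | apply: Iy].
- move=> a x Ix I [hI SI]; case: (hI) => _ _ hl _ _; apply: hl; exact: Ix.
- move=> a x Ix I [hI SI]; case: (hI) => _ _ _ hr _; apply: hr; exact: Ix.
- move=> x Ix I [hI SI]; case: (hI) => _ _ _ _ hs; apply: hs; exact: Ix.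
Qed.

Definition subalg_gen (C : numClosedFieldType) (A : algType C)
    (S : set A) : set A :=
  smallest (fun B : set A => GRing.subalg_closed [in B]) S.

(* Properness is required because the quotient is given an algType structure,
   and such algebras are nontrivial by definition. *)
Record proper_star_ideal (C : numClosedFieldType) (A : starAlgType C) :=
  ProperStarIdeal {
    psi_set :> A -> Prop;
    psi_ideal : is_star_ideal psi_set;
    psi_proper : ~ psi_set 1 }.

Section StarQuotient.
Context (C : numClosedFieldType) (A : starAlgType C).
Variable I : proper_star_ideal A.
Local Open Scope quotient_scope.

Definition psi_pred : pred A := fun x => `[< I x >].

Lemma psi_predE x : (x \in psi_pred) = `[< I x >]. Proof. by []. Qed.

Lemma psi_zmod : zmod_closed psi_pred.
Proof.
case: (psi_ideal I) => h0 hB _ _ _; split; first exact/asboolP.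
by move=> x y /asboolP Ix /asboolP Iy; apply/asboolP/hB.
Qed.

HB.instance Definition _ := GRing.isZmodClosed.Build A psi_pred psi_zmod.

Definition psi_zmodClosed : zmodClosed A :=
  GRing.ZmodClosed.clone A psi_pred _.

Definition starquot := Quotient.quot psi_zmodClosed.

HB.instance Definition _ := Choice.on starquot.
HB.instance Definition _ := GRing.Zmodule.on starquot.

Definition sqpi (x : A) : starquot := \pi_(Quotient.quot psi_zmodClosed) x.

Lemma sqpiP x y : sqpi x = sqpi y <-> I (x - y).
Proof.
split=> [/eqP|] h.
  by move: h; rewrite /sqpi -Quotient.idealrBE psi_predE => /asboolP.
by apply/eqP; rewrite /sqpi -Quotient.idealrBE psi_predE; apply/asboolP.
Qed.

Lemma sqpi_surj (u : starquot) : exists x, sqpi x = u.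
Proof. by exists (repr u); rewrite /sqpi reprK. Qed.

Definition sq_repr (u : starquot) : A := repr (u : (Quotient.quot psi_zmodClosed)).

Lemma sq_reprK u : sqpi (sq_repr u) = u.
Proof. by rewrite /sqpi reprK. Qed.

Lemma sq_reprP x : I (sq_repr (sqpi x) - x).
Proof. by apply/sqpiP; rewrite sq_reprK. Qed.

Lemma sqpiD x y : sqpi (x + y) = sqpi x + sqpi y.
Proof. by rewrite /sqpi raddfD. Qed.

End StarQuotient.

HB.lock Definition sq_mul (C : numClosedFieldType) (A : starAlgType C)
    (I : proper_star_ideal A) (u v : starquot I) : starquot I :=
  sqpi I (sq_repr u * sq_repr v).

HB.lock Definition sq_scale (C : numClosedFieldType) (A : starAlgType C)
    (I : proper_star_ideal A) (a : C) (u : starquot I) : starquot I :=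
  sqpi I (a *: sq_repr u).

HB.lock Definition sq_star (C : numClosedFieldType) (A : starAlgType C)
    (I : proper_star_ideal A) (u : starquot I) : starquot I :=
  sqpi I (star (sq_repr u)).

Section StarQuotientAlgebra.
Context (C : numClosedFieldType) (A : starAlgType C).
Variable I : proper_star_ideal A.
Local Notation starquot := (starquot I).
Local Notation sqpi := (sqpi I).
Local Notation sq_mul := (@sq_mul C A I).
Local Notation sq_scale := (@sq_scale C A I).
Local Notation sq_star := (@sq_star C A I).

Definition sq_one : starquot := sqpi 1.

Lemma sq_mulE x y : sq_mul (sqpi x) (sqpi y) = sqpi (x * y).
Proof.
rewrite sq_mul.unlock.
case: (psi_ideal I) => h0 hB hl hr _; apply/sqpiP.
set x' := sq_repr _; set y' := sq_repr _.
rewrite (_ : _ - _ = x' * (y' - y) - (x - x') * y); last first.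
  by rewrite mulrBr mulrBl opprB addrA subrK.
apply: (hB); first by apply/hl/sq_reprP.
by apply: hr; rewrite -opprB -sub0r; apply: hB => //; exact: sq_reprP.
Qed.

Lemma sq_scaleE a x : sq_scale a (sqpi x) = sqpi (a *: x).
Proof.
rewrite sq_scale.unlock.
case: (psi_ideal I) => _ _ hl _ _; apply/sqpiP.
by rewrite -scalerBr -[_ - _]mul1r scalerAl; apply/hl/sq_reprP.
Qed.

Lemma sq_starE x : sq_star (sqpi x) = sqpi (star x).
Proof.
rewrite sq_star.unlock.
case: (psi_ideal I) => _ _ _ _ hs; apply/sqpiP.
by rewrite -starB; apply/hs/sq_reprP.
Qed.

Let sqE := (sq_mulE, sq_scaleE, sq_starE, =^~ sqpiD).

Lemma sq_mulA : associative sq_mul.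
Proof.
by move=> u v w; rewrite -[u]sq_reprK -[v]sq_reprK -[w]sq_reprK !sqE mulrA.
Qed.

Lemma sq_mul1 : left_id sq_one sq_mul.
Proof. by move=> u; rewrite -[u]sq_reprK !sqE mul1r. Qed.

Lemma sq_mulr1 : right_id sq_one sq_mul.
Proof. by move=> u; rewrite -[u]sq_reprK !sqE mulr1. Qed.

Lemma sq_mulDl : left_distributive sq_mul +%R.
Proof.
by move=> u v w; rewrite -[u]sq_reprK -[v]sq_reprK -[w]sq_reprK !sqE mulrDl.
Qed.

Lemma sq_mulDr : right_distributive sq_mul +%R.
Proof.
by move=> u v w; rewrite -[u]sq_reprK -[v]sq_reprK -[w]sq_reprK !sqE mulrDr.
Qed.

Lemma sq_one_neq0 : sq_one != 0.
Proof.
apply/eqP => h; apply: (psi_proper (p := I)); rewrite -[1]subr0; apply/sqpiP.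
by rewrite -/sq_one h /sqpi raddf0.
Qed.

HB.instance Definition _ := GRing.Zmodule_isNzRing.Build starquot
  sq_mulA sq_mul1 sq_mulr1 sq_mulDl sq_mulDr sq_one_neq0.

Lemma sq_scaleA a b u : sq_scale a (sq_scale b u) = sq_scale (a * b) u.
Proof. by rewrite -[u]sq_reprK !sqE scalerA. Qed.

Lemma sq_scale1 : left_id 1 sq_scale.
Proof. by move=> u; rewrite -[u]sq_reprK !sqE scale1r. Qed.

Lemma sq_scaleDr : right_distributive sq_scale +%R.
Proof.
by move=> a u v; rewrite -[u]sq_reprK -[v]sq_reprK !sqE scalerDr.
Qed.

Lemma sq_scaleDl u : {morph sq_scale^~ u : a b / a + b}.
Proof. by move=> a b; rewrite -[u]sq_reprK !sqE scalerDl. Qed.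

HB.instance Definition _ := GRing.Zmodule_isLmodule.Build C starquot
  sq_scaleA sq_scale1 sq_scaleDr sq_scaleDl.

Lemma sqpiM x y : sqpi (x * y) = sqpi x * sqpi y.
Proof. by rewrite -sq_mulE. Qed.

Lemma sqpi1 : sqpi 1 = 1. Proof. by []. Qed.

Lemma sqpiZ a x : sqpi (a *: x) = a *: sqpi x.
Proof. by rewrite -sq_scaleE. Qed.

Lemma sq_scaleAl a (u v : starquot) : a *: (u * v) = (a *: u) * v.
Proof.
by rewrite -[u]sq_reprK -[v]sq_reprK -!(sqpiM, sqpiZ) scalerAl.
Qed.

HB.instance Definition _ := GRing.Lmodule_isLalgebra.Build C starquot
  sq_scaleAl.

Lemma sq_scaleAr a (u v : starquot) : a *: (u * v) = u * (a *: v).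
Proof.
by rewrite -[u]sq_reprK -[v]sq_reprK -!(sqpiM, sqpiZ) scalerAr.
Qed.

HB.instance Definition _ := GRing.Lalgebra_isAlgebra.Build C starquot
  sq_scaleAr.

Lemma sq_starK : involutive sq_star.
Proof. by move=> u; rewrite -[u]sq_reprK !sqE starK. Qed.

Lemma sq_starD : {morph sq_star : u v / u + v}.
Proof.
by move=> u v; rewrite -[u]sq_reprK -[v]sq_reprK -sqpiD !sq_starE starD sqpiD.
Qed.

Lemma sq_starM (u v : starquot) : sq_star (u * v) = sq_star v * sq_star u.
Proof.
by rewrite -[u]sq_reprK -[v]sq_reprK -sqpiM !sq_starE starM sqpiM.
Qed.

Lemma sq_starZ a (u : starquot) : sq_star (a *: u) = a^* *: sq_star u.
Proof. by rewrite -[u]sq_reprK -sqpiZ !sq_starE starZ sqpiZ. Qed.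

HB.instance Definition _ := Algebra_isStar.Build C starquot
  sq_starK sq_starD sq_starM sq_starZ.

Lemma sqpi_star x : sqpi (star x) = star (sqpi x).
Proof. by rewrite -sq_starE. Qed.

End StarQuotientAlgebra.

Lemma malgZU (K : choiceType) (C : nzRingType) (a x : C) (k : K) :
  a *: << x *g k >> = << a * x *g k >>.
Proof. by apply/malgP => m; rewrite mcoeffZ 2!mcoeffU mulrnAr. Qed.

Lemma malgUM (K : monomType) (C : nzRingType) (x y : C) (k l : K) :
  << x *g k >> * << y *g l >> = << x * y *g mmul k l >>.
Proof. by rewrite malgM_def fgmulUU. Qed.

(* The free *-algebra on X is the algebra of the free monoid on the letters
   (x, false), standing for x, and (x, true), standing for x^*; the involution
   conjugates coefficients, reverses words and swaps x with x^*. Its operations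
   are those of the monoid algebra, sealed so that unification does not unfold
   them. *)
Definition freestar (C : numClosedFieldType) (X : choiceType) :=
  {malg C[{fmonom (X * bool)%type}]}.

HB.instance Definition _ C X := GRing.Zmodule.on (@freestar C X).

Definition starword (X : choiceType) (w : {fmonom (X * bool)%type}) :
    {fmonom (X * bool)%type} :=
  FMonom (rev [seq (l.1, ~~ l.2) | l <- fmonom_val w]).

HB.lock Definition fs_mul (C : numClosedFieldType) (X : choiceType)
    (f g : freestar C X) : freestar C X :=
  (f : {malg C[{fmonom (X * bool)%type}]}) * g.

HB.lock Definition fs_scale (C : numClosedFieldType) (X : choiceType)
    (a : C) (f : freestar C X) : freestar C X :=
  a *: (f : {malg C[{fmonom (X * bool)%type}]}).

HB.lock Definition fs_star (C : numClosedFieldType) (X : choiceType)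
    (f : freestar C X) : freestar C X :=
  \sum_(w <- msupp f) << (f@_w)^* *g starword w >>.

HB.lock Definition fs_one (C : numClosedFieldType) (X : choiceType) :
    freestar C X :=
  << mone >>.

HB.lock Definition fs_gen (C : numClosedFieldType) (X : choiceType) (x : X) :
    freestar C X :=
  << fmu (x, false) >>.

Section FreeStar.
Context (C : numClosedFieldType) (X : choiceType).
Local Notation M := {malg C[{fmonom (X * bool)%type}]}.
Local Notation freestar := (freestar C X).

Lemma fs_mulE : @fs_mul C X = fun f g : M => f * g.
Proof. by rewrite fs_mul.unlock. Qed.

Lemma fs_scaleE : @fs_scale C X = fun (a : C) (f : M) => a *: f.
Proof. by rewrite fs_scale.unlock. Qed.

Lemma fs_oneE : @fs_one C X = 1 :> M.
Proof. by rewrite fs_one.unlock. Qed.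

Lemma fs_mulA : associative (@fs_mul C X).
Proof. by rewrite fs_mulE; exact: mulrA. Qed.

Lemma fs_mul1 : left_id (fs_one C X) (@fs_mul C X).
Proof. by rewrite fs_mulE fs_oneE; exact: mul1r. Qed.

Lemma fs_mulr1 : right_id (fs_one C X) (@fs_mul C X).
Proof. by rewrite fs_mulE fs_oneE; exact: mulr1. Qed.

Lemma fs_mulDl : left_distributive (@fs_mul C X) +%R.
Proof. by rewrite fs_mulE; exact: (@mulrDl M). Qed.

Lemma fs_mulDr : right_distributive (@fs_mul C X) +%R.
Proof. by rewrite fs_mulE; exact: (@mulrDr M). Qed.

Lemma fs_one_neq0 : fs_one C X != 0.
Proof. by rewrite fs_oneE; exact: (@oner_neq0 M). Qed.

HB.instance Definition _ := GRing.Zmodule_isNzRing.Build freestar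
  fs_mulA fs_mul1 fs_mulr1 fs_mulDl fs_mulDr fs_one_neq0.

Lemma fs_scaleA a b f : @fs_scale C X a (fs_scale b f) = fs_scale (a * b) f.
Proof. by rewrite fs_scaleE; exact: (@scalerA _ M). Qed.

Lemma fs_scale1 : left_id 1 (@fs_scale C X).
Proof. by rewrite fs_scaleE; exact: (@scale1r _ M). Qed.

Lemma fs_scaleDr : right_distributive (@fs_scale C X) +%R.
Proof. by rewrite fs_scaleE; exact: (@scalerDr _ M). Qed.

Lemma fs_scaleDl f : {morph (@fs_scale C X)^~ f : a b / a + b}.
Proof. by rewrite fs_scaleE => a b; exact: (@scalerDl _ M). Qed.

HB.instance Definition _ := GRing.Zmodule_isLmodule.Build C freestar
  fs_scaleA fs_scale1 fs_scaleDr fs_scaleDl.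

Lemma fs_scaleAl (a : C) (f g : freestar) : a *: (f * g) = (a *: f) * g.
Proof.
rewrite -[LHS]/(fs_scale a (fs_mul f g)) -[RHS]/(fs_mul (fs_scale a f) g).
by rewrite fs_mulE fs_scaleE; exact: (@scalerAl _ M).
Qed.

HB.instance Definition _ := GRing.Lmodule_isLalgebra.Build C freestar
  fs_scaleAl.

Lemma malg_scaleAr (a : C) (f g : M) : a *: (f * g) = f * (a *: g).
Proof.
rewrite (malgMEw (fsubset_refl (msupp f)) (msuppZ_le a g)) malgME scaler_sumr.
apply: eq_bigr => k _; rewrite scaler_sumr; apply: eq_bigr => l _.
by rewrite malgZU mcoeffZ mulrCA.
Qed.

Lemma fs_scaleAr (a : C) (f g : freestar) : a *: (f * g) = f * (a *: g).
Proof.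
rewrite -[LHS]/(fs_scale a (fs_mul f g)) -[RHS]/(fs_mul f (fs_scale a g)).
by rewrite fs_mulE fs_scaleE; exact: malg_scaleAr.
Qed.

HB.instance Definition _ := GRing.Lalgebra_isAlgebra.Build C freestar
  fs_scaleAr.

Lemma starwordK : involutive (@starword X).
Proof.
move=> [s]; rewrite /starword /=; congr FMonom.
rewrite map_rev revK -map_comp map_id_in // => -[x b] _ /=.
by rewrite negbK.
Qed.

Lemma starwordM (w1 w2 : {fmonom (X * bool)%type}) :
  starword (mmul w1 w2) = mmul (starword w2) (starword w1).
Proof.
by apply/eqP; rewrite fmP fmM /= -rev_cat -map_cat fmM.
Qed.

Lemma fs_starE (f : M) w : (fs_star f : M)@_w = (f@_(starword w))^*.
Proof.
rewrite fs_star.unlock [in RHS](monalgE f) !raddf_sum /=; apply: eq_bigr => k _.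
by rewrite !mcoeffU rmorphMn /= -(inv_eq starwordK) eq_sym.
Qed.

Lemma fs_starK : involutive (@fs_star C X).
Proof. by move=> f; apply/malgP => w; rewrite !fs_starE starwordK conjCK. Qed.

Lemma fs_starD : {morph @fs_star C X : f g / f + g}.
Proof.
move=> f g; apply/malgP => w.
apply: etrans (fs_starE _ _) _; apply: etrans (esym (mcoeffD _ _ _)).
apply: etrans (congr1 Num.conj (mcoeffD _ _ _)) _.
apply: etrans (rmorphD Num.conj _ _) _.
by apply: congr2; apply/esym/fs_starE.
Qed.

Lemma fs_star_sum (J : Type) (r : seq J) (F : J -> M) :
  fs_star (\sum_(j <- r) F j) = \sum_(j <- r) (fs_star (F j) : M).
Proof.
apply: (big_morph (@fs_star C X) fs_starD).
by apply/malgP => w; rewrite fs_starE !mcoeff0 rmorph0.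
Qed.

Lemma fs_starU (a : C) w :
  @fs_star C X << a *g w >> = << a^* *g starword w >>.
Proof.
apply/malgP => k; rewrite fs_starE !mcoeffU rmorphMn /=.
by rewrite -(inv_eq starwordK) eq_sym.
Qed.

Lemma malg_starM (f g : M) :
  fs_star (f * g) = (fs_star g : M) * (fs_star f : M).
Proof.
rewrite malgME fs_star_sum [in RHS]fs_star.unlock.
rewrite [RHS]big_distrlr [RHS]exchange_big /=.
apply: eq_bigr => k _; rewrite fs_star_sum; apply: eq_bigr => l _.
by rewrite fs_starU starwordM rmorphM mulrC malgUM.
Qed.

Lemma fs_starM (f g : freestar) : fs_star (f * g) = fs_star g * fs_star f.
Proof.
rewrite -[X in X = _]/(fs_star (fs_mul f g)).
rewrite -[X in _ = X]/(fs_mul (fs_star g) (fs_star f)).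
by rewrite fs_mulE; exact: malg_starM.
Qed.

Lemma fs_starZ (a : C) (f : freestar) : fs_star (a *: f) = a^* *: fs_star f.
Proof.
rewrite -[X in X = _]/(fs_star (fs_scale a f)).
rewrite -[X in _ = X]/(fs_scale _ (fs_star f)) fs_scaleE.
apply/malgP => w.
apply: etrans (fs_starE _ _) _; apply: etrans (esym (mcoeffZ _ _ _)).
apply: etrans (congr1 Num.conj (mcoeffZ _ _ _)) _.
apply: etrans (rmorphM Num.conj _ _) _.
by apply: congr2 => //; apply/esym/fs_starE.
Qed.

HB.instance Definition _ := Algebra_isStar.Build C freestar
  fs_starK fs_starD fs_starM fs_starZ.

(* fs_eval is the *-character with values v on the generators; it serves to
   prove that the ideals of relations below are proper. *)
Section Character.
Variable v : X -> C.

Definition fs_evalword (w : {fmonom (X * bool)%type}) : C :=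
  \prod_(l <- fmonom_val w) (if l.2 then (v l.1)^* else v l.1).

Lemma fs_evalword_mmorphism : mmorphism fs_evalword.
Proof.
split=> [w1 w2|]; first by rewrite /fs_evalword fmM big_cat.
by rewrite /fs_evalword fm1 big_nil.
Qed.

HB.instance Definition _ := isMultiplicative.Build _ _ fs_evalword
  fs_evalword_mmorphism.

Definition fs_eval (f : freestar) : C := mmap idfun fs_evalword f.

Lemma fs_evalB (f g : freestar) : fs_eval (f - g) = fs_eval f - fs_eval g.
Proof. exact: (mmapB (f := idfun) (h := fs_evalword)). Qed.

Lemma fs_evalD (f g : freestar) : fs_eval (f + g) = fs_eval f + fs_eval g.
Proof. exact: (mmapD (f := idfun) (h := fs_evalword)). Qed.

Lemma fs_eval0 : fs_eval 0 = 0.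
Proof. exact: (mmap0 (f := idfun) (h := fs_evalword)). Qed.

Lemma fs_evalN (f : freestar) : fs_eval (- f) = - fs_eval f.
Proof. exact: (mmapN (f := idfun) (h := fs_evalword)). Qed.

Lemma fs_evalM (f g : freestar) : fs_eval (f * g) = fs_eval f * fs_eval g.
Proof.
rewrite -[f * g]/(fs_mul f g) fs_mulE.
exact: (rmorphM (mmap idfun fs_evalword)).
Qed.

Lemma fs_evalZ a (f : freestar) : fs_eval (a *: f) = a * fs_eval f.
Proof. by rewrite -[a *: f]/(fs_scale a f) fs_scaleE; exact: mmapZ. Qed.

Lemma fs_eval1 : fs_eval 1 = 1.
Proof. by rewrite -[1 in LHS]/(fs_one C X) fs_oneE; exact: mmap1. Qed.

Lemma fs_evalXn (f : freestar) n : fs_eval (f ^+ n) = fs_eval f ^+ n.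
Proof.
elim: n => [|n ihn]; first by rewrite !expr0 fs_eval1.
by rewrite !exprS fs_evalM ihn.
Qed.

Lemma fs_eval_gen x : fs_eval (fs_gen C x) = v x.
Proof.
by rewrite /fs_eval fs_gen.unlock mmapU /= mul1r /fs_evalword fmU big_seq1.
Qed.

Lemma fs_evalword_star w : fs_evalword (starword w) = (fs_evalword w)^*.
Proof.
rewrite /fs_evalword /= (perm_big _ (permEl (perm_rev _))) big_map rmorph_prod.
by apply: eq_bigr => -[x [|]] _ /=; rewrite ?conjCK.
Qed.

Lemma fs_eval_star (f : freestar) : fs_eval (star f) = (fs_eval f)^*.
Proof.
rewrite -[star f]/(fs_star f) fs_star.unlock {2}/fs_eval mmapE rmorph_sum.
rewrite /fs_eval (raddf_sum (mmap idfun fs_evalword)); apply: eq_bigr => w _.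
by rewrite /= mmapU /= rmorphM fs_evalword_star.
Qed.

Lemma fs_eval_proper (S : set freestar) :
  (forall f, S f -> fs_eval f = 0) -> ~ star_ideal_gen S 1.
Proof.
move=> S0 /(_ [set f | fs_eval f = 0]); rewrite /= fs_eval1.
apply/not_implyP; split; last exact/eqP/oner_neq0.
split=> //; split=> /=.
- exact: fs_eval0.
- by move=> f g f0 g0; rewrite fs_evalB f0 g0 subrr.
- by move=> a f f0; rewrite fs_evalM f0 mulr0.
- by move=> a f f0; rewrite fs_evalM f0 mul0r.
- by move=> f f0; rewrite fs_eval_star f0 rmorph0.
Qed.

End Character.

End FreeStar.

Section PodlesRelations.
Context (C : numClosedFieldType) (q : C).
Local Notation F := (freestar C 'I_2).

Let A : F := fs_gen C ord0.
Let B : F := fs_gen C ord_max.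

Definition podles_rels_fin (c : C) : set F :=
  [set star A - A;
       B * A - q ^+ 2 *: (A * B);
       star B * B - (A - A ^+ 2 + c *: 1);
       B * star B - (q ^+ 2 *: A - q ^+ 4 *: A ^+ 2 + c *: 1)].

Definition podles_rels_infty : set F :=
  [set star A - A;
       B * A - q ^+ 2 *: (A * B);
       star B * B - (- A ^+ 2 + 1);
       B * star B - (- (q ^+ 4 *: A ^+ 2) + 1)].

Section Character.
Variable b : C.
Hypothesis b_real : b^* = b.

Let v (i : 'I_2) : C := if i == ord0 then 0 else b.

Let vA : fs_eval v A = 0. Proof. by rewrite fs_eval_gen. Qed.
Let vB : fs_eval v B = b. Proof. by rewrite fs_eval_gen. Qed.
Let vA' : fs_eval v (star A) = 0. Proof. by rewrite fs_eval_star vA rmorph0. Qed.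
Let vB' : fs_eval v (star B) = b. Proof. by rewrite fs_eval_star vB b_real. Qed.

Let rel1 : fs_eval v (star A - A) = 0.
Proof. by rewrite fs_evalB vA vA' subrr. Qed.

Let rel2 : fs_eval v (B * A - q ^+ 2 *: (A * B)) = 0.
Proof.
by rewrite fs_evalB fs_evalZ 2!fs_evalM vA vB mulr0 mul0r mulr0 subrr.
Qed.

Lemma podles_rels_fin_proper c :
  b * b = c -> ~ star_ideal_gen (podles_rels_fin c) 1.
Proof.
move=> bb; apply: (@fs_eval_proper _ _ v) => f [[[|]|]|] -> //.
  rewrite fs_evalB 2!fs_evalD fs_evalN fs_evalZ fs_eval1 fs_evalXn fs_evalM.
  by rewrite vA vB vB' bb expr0n oppr0 addr0 add0r mulr1 subrr.
rewrite fs_evalB fs_evalD fs_evalB 3!fs_evalZ fs_eval1 fs_evalXn fs_evalM.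
by rewrite vA vB vB' bb expr0n /= !mulr0 subrr add0r mulr1 subrr.
Qed.

Lemma podles_rels_infty_proper :
  b * b = 1 -> ~ star_ideal_gen podles_rels_infty 1.
Proof.
move=> bb; apply: (@fs_eval_proper _ _ v) => f [[[|]|]|] -> //.
  rewrite fs_evalB fs_evalD fs_evalN fs_eval1 fs_evalXn fs_evalM.
  by rewrite vA vB vB' bb expr0n oppr0 add0r subrr.
rewrite fs_evalB fs_evalD fs_evalN fs_evalZ fs_eval1 fs_evalXn fs_evalM.
by rewrite vA vB vB' bb expr0n /= mulr0 oppr0 add0r subrr.
Qed.

End Character.
End PodlesRelations.

Section Podles.
Context (R : realType) (q : R).
Local Notation "r %:C" := (real_complex R r).
Local Notation F := (freestar R[i] 'I_2).

(* Only 0 <= c is meaningful; the value at -oo is irrelevant. *)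
Definition podles_rels (c : \bar R) : set F :=
  if c is EFin r then podles_rels_fin q%:C r%:C else podles_rels_infty q%:C.

Lemma podles_rels_proper (c : \bar R) :
  (0 <= c)%E -> ~ star_ideal_gen (podles_rels c) 1.
Proof.
have realC (r : R) : Num.conj (r%:C) = r%:C.
  by apply/conj_Creal/complex_realP; exists r.
case: c => [r||] //= r0.
  apply: (podles_rels_fin_proper (realC (Num.sqrt r))).
  by rewrite -rmorphM -expr2 sqr_sqrtr.
apply: (@podles_rels_infty_proper _ _ 1); first exact: rmorph1.
exact: mulr1.
Qed.

Definition podles_ideal (c : \bar R) (hc : (0 <= c)%E) :
    proper_star_ideal F :=
  ProperStarIdeal (star_ideal_genP (podles_rels c)) (podles_rels_proper hc).

Definition podles (c : \bar R) (hc : (0 <= c)%E) : starAlgType R[i] :=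
  starquot (podles_ideal hc).

Definition podlesA (c : \bar R) (hc : (0 <= c)%E) : podles hc :=
  sqpi (podles_ideal hc) (fs_gen R[i] ord0).

Definition podlesB (c : \bar R) (hc : (0 <= c)%E) : podles hc :=
  sqpi (podles_ideal hc) (fs_gen R[i] ord_max).

Definition tilde_factor (c : \bar R) : R :=
  if c is EFin r then (1 + Num.sqrt r)^-1 else 1.

Definition podlesAt (c : \bar R) (hc : (0 <= c)%E) : podles hc :=
  (tilde_factor c)%:C *: podlesA hc.

Definition podlesBt (c : \bar R) (hc : (0 <= c)%E) : podles hc :=
  (tilde_factor c)%:C *: podlesB hc.

Definition z_infty (c : \bar R) : R :=
  if c is EFin r
  then - (Num.sqrt (8 * r * ((1 + q ^+ 4) / (1 + q ^+ 2) ^+ 2) + 1))^-1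
  else 0.

(* The value at +oo is the limit of (1 + sqrt c) * z_infty c as c -> +oo. *)
Definition kappa (c : \bar R) : R :=
  if c is EFin r then (1 + Num.sqrt r) * z_infty c
  else - ((1 + q ^+ 2) / (2 * Num.sqrt (2 * (1 + q ^+ 4)))).

End Podles.

(* Main.v *)
Require Import Defs.
From mathcomp Require Import all_boot all_order all_algebra.
From mathcomp Require Import finmap monalg.
From mathcomp Require Import complex.
From mathcomp Require Import boolp classical_sets reals constructive_ereal.
From mathcomp Require Import ring lra.

Set Implicit Arguments.
Unset Strict Implicit.
Unset Printing Implicit Defensive.

Import Order.TTheory GRing.Theory Num.Theory.

Local Open Scope ring_scope.
Local Open Scope classical_set_scope.

(** Write a, b for the rescaled generators, p for s kappa and m for
2 (1 + q^4) / (1 + q^2) kappa, so that x = - i p (b - b^* ),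
y = - p (b + b^* ) and z = - m a + z_infty.

Self-adjointness holds because a is self-adjoint and all scalars except i are
real. For the sphere equation, x^2 + y^2 = 2 p^2 (b^* b + b b^* ).
Adding the last two defining relations, the anticommutator b^* b + b b^* is a quadratic polynomial in a
([podlesBt_anticommutator]), so that x^2 + y^2 + z^2 is one as well
([sum_of_squares]). Its linear and quadratic coefficients vanish and its
constant coefficient is 1 by three identities between real numbers
([sphere_lin], [sphere_quad], [sphere_cst]).

For generation, p and m are nonzero since kappa is negative, so the linear
change of elements is invertible: a, b and b^* are affine combinations of
x, y, z ([sphere_generators]). A quotient of a free star-algebra is generated,
as an algebra, by the classes of the letters and of their adjoints
([subalg_gen_starquot]). *)

(** * The sum of squares *)

(** The two displayed elements in b and b' are chosen so that the sum of their
squares cancels b ^+ 2 and b' ^+ 2, leaving the anticommutator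
b' * b + b * b'. If that is a polynomial of degree 2 in a, the sum of the
three squares is again a polynomial in a; the three scalar hypotheses compare
its coefficients with those of 1. *)
Lemma sum_of_squares (C : numClosedFieldType) (A : algType C) (a b b' : A)
    (al be ga p m w : C) :
  b' * b + b * b' = al *: a + be *: a ^+ 2 + ga *: 1 ->
  p ^+ 2 * al = m * w -> 2 * p ^+ 2 * be = - m ^+ 2 ->
  2 * p ^+ 2 * ga + w ^+ 2 = 1 ->
  ((- 'i * p) *: (b - b')) ^+ 2 + ((- p) *: (b + b')) ^+ 2
    + ((- m) *: a + w *: 1) ^+ 2 = 1.
Proof.
move=> bE lin quad cst.
have zE : ((- m) *: a + w *: 1 : A) ^+ 2 =
    m ^+ 2 *: a ^+ 2 - (2 * (m * w)) *: a + w ^+ 2 *: 1.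
  rewrite !expr2 mulrDl !mulrDr -!scalerAl -!scalerAr !scalerA !mulr1 !mul1r.
  rewrite mulrNN addrA -[_ + _ + _ *: a]addrA -scalerDl -scaleNr.
  by congr (_ + _ *: _ + _); ring.
have xyE : ((- 'i * p) *: (b - b')) ^+ 2 + ((- p) *: (b + b')) ^+ 2 =
    (2 * p ^+ 2) *: (b' * b + b * b').
  rewrite !exprZn exprMn !sqrrN sqrCi mulN1r scaleNr addrC -scalerBr.
  rewrite [2 * _]mulrC -[RHS]scalerA; congr (_ *: _).
  rewrite !expr2 mulrDl mulrBl !mulrDr !mulrN !opprD !opprK scaler_nat mulr2n.
  rewrite (AC ((2*2)*(2*2)) ((1*5)*(4*8)*((3*2)*(7*6)))) /= !subrr.
  by rewrite !add0r.
rewrite xyE zE bE !scalerDr !scalerA quad -mulrA lin scaleNr.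
rewrite (AC (3*3) ((1*5)*(2*4)*(3*6))) /= subrr addNr !add0r -scalerDl.
by rewrite cst scale1r.
Qed.

(** * Generation by the letters and their adjoints *)

Lemma starwordU (X : choiceType) (l : X * bool) :
  starword (fmu l) = fmu (l.1, ~~ l.2).
Proof. by apply/eqP; rewrite fmP fmU /= fmU. Qed.

(** The free star-algebra is spanned by words, and a word is a product of letters
x and x^*. *)
Lemma freestar_ind (C : numClosedFieldType) (X : choiceType)
    (P : freestar C X -> Prop) :
  P 1 -> (forall a f g, P f -> P g -> P (a *: f + g)) ->
  (forall f g, P f -> P g -> P (f * g)) ->
  (forall x, P (fs_gen C x)) -> (forall x, P (star (fs_gen C x))) ->
  forall f, P f.
Proof.
move=> P1 PD PM Pg Ps f.
have P0 : P 0 by rewrite -(subrr 1) addrC -scaleN1r; apply: PD.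
have PA g h : P g -> P h -> P (g + h).
  by move=> Pg1 /(PD 1 _ _ Pg1); rewrite scale1r.
have Pl (l : X * bool) : P (<< fmu l >> : {malg C[{fmonom (X * bool)%type}]}).
  case: l => x [|]; last by move: (Pg x); rewrite fs_gen.unlock.
  move: (Ps x); rewrite -[star _]/(fs_star _) fs_gen.unlock fs_starU rmorph1.
  by rewrite starwordU.
have Pw (w : {fmonom (X * bool)%type}) :
    P (<< w >> : {malg C[{fmonom (X * bool)%type}]}).
  case: w; elim=> [|l s IHs].
    move: P1; rewrite -[1]/(fs_one C X) fs_one.unlock.
    by congr (P << _ >>); apply/eqP; rewrite fmP fm1.
  have := PM _ _ (Pl l) IHs; rewrite -[_ * _]/(fs_mul _ _) fs_mulE malgUM mulr1.
  by congr (P << _ >>); apply/eqP; rewrite fmP fmM fmU.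
rewrite [f]monalgE; elim/big_ind : _ => // w _.
have := PD f@_w _ _ (Pw w) P0.
by rewrite addr0 -[_ *: _]/(fs_scale _ _) fs_scaleE malgZU mulr1.
Qed.

Section GeneratedSubalgebra.
Context (C : numClosedFieldType) (A : algType C) (S : set A).

Lemma subalg_gen_closed :
  [/\ subalg_gen S 1,
      forall k f g, subalg_gen S f -> subalg_gen S g ->
        subalg_gen S (k *: f + g) &
      forall f g, subalg_gen S f -> subalg_gen S g -> subalg_gen S (f * g)].
Proof.
split=> [D [[D1 _ _] _]|k f g Sf Sg D [hD SD]|f g Sf Sg D [hD SD]].
- by rewrite inE in D1.
- case: (hD) => _ + _; move=> /(_ k f g); rewrite !inE.
  by apply; [apply: Sf | apply: Sg].
- case: (hD) => _ _ /(_ f g); rewrite !inE.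
  by apply; [apply: Sf | apply: Sg].
Qed.

Lemma subalg_genZ k f : subalg_gen S f -> subalg_gen S (k *: f).
Proof.
have [S1 SD _] := subalg_gen_closed; move=> Sf.
rewrite -[_ *: _]addr0 -(addNr 1) -scaleN1r.
by apply: (SD) => //; apply: SD.
Qed.

Lemma subalg_genD f g :
  subalg_gen S f -> subalg_gen S g -> subalg_gen S (f + g).
Proof.
by have [_ SD _] := subalg_gen_closed; rewrite -[f in f + g]scale1r; exact: SD.
Qed.

Lemma subalg_genZK k f : k != 0 -> subalg_gen S (k *: f) -> subalg_gen S f.
Proof.
by move=> k0 /(subalg_genZ k^-1); rewrite scalerA mulVf// scale1r.
Qed.

End GeneratedSubalgebra.

(** Dividing by the nonzero scalars p and m gives b - b', b + b' and
a up to a multiple of 1; the sum and the difference of the first two are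
2 b and 2 b'. *)
Lemma sphere_generators (C : numClosedFieldType) (A : algType C) (S : set A)
    (a b b' : A) (p m w : C) : p != 0 -> m != 0 ->
  subalg_gen S ((- 'i * p) *: (b - b')) -> subalg_gen S ((- p) *: (b + b')) ->
  subalg_gen S ((- m) *: a + w *: 1) ->
  [/\ subalg_gen S a, subalg_gen S b & subalg_gen S b'].
Proof.
move=> p0 m0 /subalg_genZK Sdiff /subalg_genZK Ssum Sz.
have {}Sdiff : subalg_gen S (b - b').
  by apply: Sdiff; rewrite mulf_neq0 ?oppr_eq0 ?neq0Ci.
have {}Ssum : subalg_gen S (b + b') by apply: Ssum; rewrite oppr_eq0.
have two0 : 2 != 0 :> C by rewrite pnatr_eq0.
split.
- apply: (@subalg_genZK _ _ _ (- m)); first by rewrite oppr_eq0.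
  rewrite -[_ *: a](addrK (w *: 1)) -scaleNr; apply: subalg_genD => //.
  by apply: subalg_genZ; case: (subalg_gen_closed S).
- apply: (subalg_genZK two0); rewrite scaler_nat mulr2n.
  rewrite -{1}[b](subrK b') -addrA [b' + b]addrC.
  exact: subalg_genD.
- apply: (subalg_genZK two0); rewrite scaler_nat mulr2n.
  rewrite -{1}[b'](subrK b) -addrA -opprB -scaleN1r.
  by apply: subalg_genD => //; apply: subalg_genZ.
Qed.

Lemma subalg_gen_starquot (C : numClosedFieldType) (X : choiceType)
    (I : proper_star_ideal (freestar C X)) (S : set (starquot I)) :
  (forall x, subalg_gen S (sqpi I (fs_gen C x))) ->
  (forall x, subalg_gen S (star (sqpi I (fs_gen C x)))) ->
  subalg_gen S = setT.
Proof.
move=> Sg Ss; apply/seteqP; split=> // u _; have [f <-] := sqpi_surj u.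
have [S1 SD SM] := subalg_gen_closed S.
elim/freestar_ind: f => //.
- by move=> k f g Sf Sg'; rewrite sqpiD sqpiZ; apply: SD.
- by move=> f g Sf Sg'; rewrite sqpiM; apply: SM.
- by move=> x; rewrite sqpi_star; apply: Ss.
Qed.

(** * The Podles spheres *)

Section PodlesSphere.
Context (R : realType) (q : R).
Implicit Types (c : \bar R).
Local Notation "r %:C" := (real_complex R r).

(** The linear and constant coefficients of the anticommutator of the rescaled
generators. They depend on c; the quadratic coefficient - (1 + q^4) is the same for all c, because the rescaling
multiplies the square of the first generator and the anticommutator alike. *)
Definition anticomm_lin c : R :=
  if c is EFin _ then tilde_factor c * (1 + q ^+ 2) else 0.

Definition anticomm_cst c : R :=
  if c is EFin r then 2 * r * tilde_factor c ^+ 2 else 2.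

Lemma conj_real_complex (r : R) : (r%:C)^* = r%:C.
Proof. by apply/conj_Creal/complex_realP; exists r. Qed.

Lemma podles_rel c (hc : (0 <= c)%E) (f g : freestar R[i] 'I_2) :
  podles_rels q c (f - g) ->
  sqpi (podles_ideal q hc) f = sqpi (podles_ideal q hc) g.
Proof. by move=> fg; apply/sqpiP => I [_]; apply. Qed.

Lemma podlesA_star c (hc : (0 <= c)%E) : star (podlesA q hc) = podlesA q hc.
Proof.
rewrite /podlesA -sqpi_star; apply: podles_rel; rewrite /podles_rels.
by case: c hc => [r||] // _; do 3 left.
Qed.

Lemma podlesAt_star c (hc : (0 <= c)%E) : star (podlesAt q hc) = podlesAt q hc.
Proof. by rewrite starZ podlesA_star conj_real_complex. Qed.

(** Sum of the relations for B^* B and B B^*, multiplied by the square of the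
scaling factor. *)
Lemma podlesBt_anticommutator c (hc : (0 <= c)%E) :
  star (podlesBt q hc) * podlesBt q hc + podlesBt q hc * star (podlesBt q hc) =
  (anticomm_lin c)%:C *: podlesAt q hc
    + (- (1 + q ^+ 4)%:C) *: podlesAt q hc ^+ 2 + (anticomm_cst c)%:C *: 1.
Proof.
rewrite starZ conj_real_complex exprZn -!scalerAl -!scalerAr !scalerA -scalerDr.
rewrite -sqpi_star -!sqpiM.
rewrite /podlesA /anticomm_lin /anticomm_cst /tilde_factor.
set A := fs_gen _ ord0; set B := fs_gen _ ord_max.
have sqpiN c' (hc' : (0 <= c')%E) f :
    sqpi (podles_ideal q hc') (- f) = - sqpi (podles_ideal q hc') f.
  by rewrite /sqpi raddfN.
have sqE := (sqpiD, sqpiN, sqpiM, sqpiZ, sqpi1, expr2).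
case: c hc => [r||] // hc'.
- have -> := podles_rel hc' (f := star B * B)
    (g := A - A ^+ 2 + r%:C *: 1) ltac:(by left; right).
  have -> := podles_rel hc' (f := B * star B)
    (g := q%:C ^+ 2 *: A - q%:C ^+ 4 *: A ^+ 2 + r%:C *: 1) ltac:(by right).
  rewrite !sqE; set a := sqpi _ A; rewrite (AC (3*3) ((1*4)*(2*5)*(3*6))) /=.
  have -> : a + (q%:C * q%:C) *: a = (1 + q%:C * q%:C) *: a.
    by rewrite scalerDl scale1r.
  have -> : - (a * a) - q%:C ^+ 4 *: (a * a) = (- (1 + q%:C ^+ 4)) *: (a * a).
    by rewrite scaleNr scalerDl scale1r opprD.
  rewrite -scalerDl !scalerDr !scalerA -?rmorphXn /=.
  by congr (_ *: _ + _ *: _ + _ *: _); ring.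
- have -> := podles_rel hc' (f := star B * B)
    (g := - A ^+ 2 + 1) ltac:(by left; right).
  have -> := podles_rel hc' (f := B * star B)
    (g := - (q%:C ^+ 4 *: A ^+ 2) + 1) ltac:(by right).
  rewrite !sqE; set a := sqpi _ A; rewrite (AC (2*2) ((1*3)*(2*4))) /=.
  have -> : - (a * a) - q%:C ^+ 4 *: (a * a) = (- (1 + q%:C ^+ 4)) *: (a * a).
    by rewrite scaleNr scalerDl scale1r opprD.
  rewrite rmorph0 mul0r scale0r add0r rmorph1 !mulr1 scale1r.
  by rewrite -mulr2n -scaler_nat rmorphD rmorphXn rmorph1 rmorph_nat.
Qed.

Lemma tilde_factor_gt0 c : 0 < tilde_factor c.
Proof.
by case: c => [r||] //=; rewrite invr_gt0 ltr_wpDr ?sqrtr_ge0.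
Qed.

Lemma tilde_kappa (r : R) :
  tilde_factor r%:E * kappa q r%:E = z_infty q r%:E.
Proof. by rewrite mulKf // gt_eqF // ltr_wpDr ?sqrtr_ge0. Qed.

Lemma kappa_lt0 c : (0 <= c)%E -> kappa q c < 0.
Proof.
have q2 : 0 <= q ^+ 2 by exact: sqr_ge0.
have q4 : 0 <= q ^+ 4 by rewrite exprn_even_ge0.
case: c => [r||] //= r0.
  rewrite mulrN oppr_lt0 mulr_gt0 ?invr_gt0 ?ltr_wpDr ?sqrtr_ge0 //.
  rewrite sqrtr_gt0 ltr_wpDl // !mulr_ge0 // ?invr_ge0 ?addr_ge0 ?sqr_ge0 //.
by rewrite oppr_lt0 divr_gt0 ?mulr_gt0 ?sqrtr_gt0 ?mulr_gt0 //; lra.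
Qed.

(* The scalars of the statement: x and y carry s * kappa, and z carries m. *)
Local Notation s := (Num.sqrt (2 * (1 + q ^+ 4)) / (1 + q ^+ 2)).
Local Notation m c := (2 * (1 + q ^+ 4) / (1 + q ^+ 2) * kappa q c).

Lemma sqr_s : s ^+ 2 = 2 * (1 + q ^+ 4) / (1 + q ^+ 2) ^+ 2.
Proof.
by rewrite expr_div_n sqr_sqrtr // mulr_ge0 // addr_ge0 // exprn_even_ge0.
Qed.

(** For finite c both sides are 2 (1 + q^4) / (1 + q^2) * kappa * z_infty, since
kappa times the scaling factor is z_infty; at infinity both vanish. *)
Lemma sphere_lin c :
  (0 <= c)%E -> (s * kappa q c) ^+ 2 * anticomm_lin c = m c * z_infty q c.
Proof.
have q2 : 0 <= q ^+ 2 by exact: sqr_ge0.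
rewrite exprMn sqr_s; case: c => [r _||] //; last by rewrite /= !mulr0.
by rewrite /anticomm_lin -tilde_kappa; field; lra.
Qed.

Lemma sphere_quad c :
  2 * (s * kappa q c) ^+ 2 * (- (1 + q ^+ 4)) = - m c ^+ 2.
Proof.
have q2 : 0 <= q ^+ 2 by exact: sqr_ge0.
rewrite exprMn sqr_s; field; lra.
Qed.

(** For finite c the left-hand side is the square of z_infty times the number
whose inverse square root defines z_infty; at infinity z_infty = 0 and kappa is
normalised so that s * kappa = - 1/2. *)
Lemma sphere_cst c : (0 <= c)%E ->
  2 * (s * kappa q c) ^+ 2 * anticomm_cst c + z_infty q c ^+ 2 = 1.
Proof.
have q2 : 0 <= q ^+ 2 by exact: sqr_ge0.
have q4 : 0 <= q ^+ 4 by rewrite exprn_even_ge0.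
rewrite exprMn sqr_s; case: c => [r r0||] // => [|_].
  have -> : 2 * (2 * (1 + q ^+ 4) / (1 + q ^+ 2) ^+ 2 * kappa q r%:E ^+ 2)
      * anticomm_cst r%:E + z_infty q r%:E ^+ 2
    = (8 * r * ((1 + q ^+ 4) / (1 + q ^+ 2) ^+ 2) + 1) * z_infty q r%:E ^+ 2.
    by rewrite /anticomm_cst -tilde_kappa; field; lra.
  rewrite lee_fin in r0.
  have d0 : 0 < 8 * r * ((1 + q ^+ 4) / (1 + q ^+ 2) ^+ 2) + 1.
    by rewrite ltr_wpDl // !mulr_ge0 // ?invr_ge0 ?sqr_ge0 // addr_ge0.
  by rewrite /= sqrrN exprVn sqr_sqrtr ?mulfV ?gt_eqF // ltW.
rewrite /= expr0n addr0 sqrrN expr_div_n exprMn sqr_sqrtr; last lra.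
by field; lra.
Qed.

End PodlesSphere.

Theorem mainTheorem1 (R : realType) (q : R) (hq0 : 0 < `|q|) (hq1 : `|q| < 1)
    (c : \bar R) (hc : (0 <= c)%E) :
  let At := podlesAt q hc in
  let Bt := podlesBt q hc in
  let zoo := z_infty q c in
  let kap := kappa q c in
  let s := Num.sqrt (2 * (1 + q ^+ 4)) / (1 + q ^+ 2) in
  let x : podles q hc :=
    (- 'i%C * (s * kap)%:C%C) *: (Bt - star Bt) in
  let y : podles q hc :=
    (- (s * kap))%:C%C *: (Bt + star Bt) in
  let z : podles q hc :=
    (- (2 * (1 + q ^+ 4) / (1 + q ^+ 2) * kap))%:C%C *: At + zoo%:C%C *: 1 in
  [/\ [/\ star x = x, star y = y & star z = z],
      x ^+ 2 + y ^+ 2 + z ^+ 2 = 1 &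
      subalg_gen [set x; y; z] = setT].
Proof.
move=> At Bt zoo kap s x y z.
pose p := s * kap; pose m := 2 * (1 + q ^+ 4) / (1 + q ^+ 2) * kap.
have realC := @conj_real_complex R.
split.
- split.
  + have conj_ip : (- 'i%C * p%:C%C)^* = 'i%C * p%:C%C :> R[i].
      rewrite complexiE; apply: etrans (rmorphM Num.conj _ _) _.
      congr (_ * _); last exact: realC.
      apply: etrans (rmorphN Num.conj _) _.
      exact: etrans (congr1 -%R (conjCi _)) (opprK _).
    by rewrite /x starZ starB starK conj_ip mulNr scaleNr -scalerN opprB.
  + by rewrite /y starZ starD starK realC addrC.
  + have AtE : star At = At by exact: podlesAt_star.
    by rewrite /z starD (starZ _ At) (starZ _ 1) star1 AtE !realC.
- rewrite /x /y /z -!/p -!/m !rmorphN /= complexiE.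
  apply: (sum_of_squares (podlesBt_anticommutator q hc)).
  + by rewrite -rmorphXn -!rmorphM sphere_lin.
  + rewrite -!rmorphXn -rmorphN -[2](rmorph_nat (real_complex R)) -!rmorphM.
    by rewrite sphere_quad -rmorphN.
  + rewrite -!rmorphXn -[2](rmorph_nat (real_complex R)) -!rmorphM -rmorphD.
    by rewrite sphere_cst ?rmorph1.
- have q2 : 0 < 1 + q ^+ 2 by rewrite ltr_wpDr ?sqr_ge0.
  have q4 : 0 < 1 + q ^+ 4 by rewrite ltr_wpDr ?exprn_even_ge0.
  have kap0 : kap != 0 by rewrite lt_eqF ?kappa_lt0.
  have realC0 (r : R) : r != 0 -> r%:C%C != 0 by rewrite fmorph_eq0.
  have [Sx Sy Sz] : [/\ subalg_gen [set x; y; z] x, subalg_gen [set x; y; z] y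
      & subalg_gen [set x; y; z] z].
    by split=> D [_]; apply; [left; left | left; right | right].
  have [] := @sphere_generators _ _ [set x; y; z] At Bt (star Bt)
    p%:C%C m%:C%C zoo%:C%C.
  + rewrite realC0 // mulf_neq0 // mulf_neq0 ?invr_eq0 ?gt_eqF //.
    by rewrite sqrtr_gt0 mulr_gt0.
  + by rewrite realC0 // !mulf_neq0 // ?invr_eq0 ?gt_eqF.
  + by rewrite -complexiE.
  + by rewrite -rmorphN.
  + by rewrite -rmorphN.
  have tau0 := realC0 _ (lt0r_neq0 (tilde_factor_gt0 c)).
  move=> /(subalg_genZK tau0) SA /(subalg_genZK tau0) SB.
  rewrite starZ realC => /(subalg_genZK tau0) SB'.
  have letterE (i : 'I_2) : i = ord0 \/ i = ord_max.
    by case: i => [[|[|]]] // lt_i; [left | right]; apply: val_inj.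
  apply: (@subalg_gen_starquot _ _ (podles_ideal q hc)) => i.
  + by have [->|->] := letterE i; [exact: SA | exact: SB].
  + have [->|->] := letterE i; last exact: SB'.
    by move: SA; rewrite -podlesA_star; exact.
Qed.
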